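(* For the height algebra $\mathcal H=(\mathbb N_{-\infty},\vee,\star,-\infty)$, the following hold. (1) Maximum is the unique commutative, associative, idempotent binary operation on $\mathbb N_{-\infty}$ with identity $-\infty$ over which $\star$ distributes. (2) The subalgebras of $\mathcal H$ are $\{-\infty\}$ and the upward tails $\{-\infty\}\cup\{m,m+1,m+2,\dots\}$ for $m\in\mathbb N$. (3) Every endomorphism of $\mathcal H$ is either the constant map to $-\infty$ or a translation of the finite heights, i.e. a map $\tau_c$ with $c\in\mathbb N$, where $\tau_c(-\infty)=-\infty$ and $\tau_c(x)=x+c$ for $x\in\mathbb N$. In particular, $\mathcal H$ is rigid: its only automorphism is the identity map. (4) Every congruence of $\mathcal H$ other than equality and the universal relation collapses a unique final tail of finite heights and fixes every other element; that is, it equals $\theta_m$ for a unique $m\in\mathbb N$, where the only nonsingleton class of $\theta_m$ is $\{m,m+1,m+2,\dots\}$. Consequently, the nontrivial finite quotients of $\mathcal H$ are, up to isomorphism, the algebras $\mathcal H/\theta_m$ ($m\in\mathbb N$), obtained by capping all heights at or above a finite threshold. (5) The algebra $\mathcal H$, and every finite power $\mathcal H^n$ of $\mathcal H$, is residually finite.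
   Context: $\mathbb N=\{0,1,2,\dots\}$ and $\mathbb N_{-\infty}=\mathbb N\cup\{-\infty\}$, with $-\infty<k$ and $-\infty+k=-\infty$ for $k\in\mathbb N$. The height algebra $\mathcal H=(\mathbb N_{-\infty},\vee,\star,-\infty)$ has operations $a\vee b=\max\{a,b\}$, $a\star b=\max\{a,b\}+1$, and the named constant $-\infty$; subalgebras, endomorphisms and congruences are taken in this signature $(\vee,\star,-\infty)$. $\mathcal H^n$ is the direct power with coordinatewise operations. An algebra is nontrivial if it has more than one element. An algebra is residually finite if any two distinct elements remain distinct in some finite quotient (quotient by a congruence with finitely many classes). *)

(* Defs.v *)
From mathcomp Require Import all_boot.
From mathcomp Require Import boolp classical_sets functions cardinality.

Set Implicit Arguments.
Unset Strict Implicit.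
Unset Printing Implicit Defensive.

Local Open Scope quotient_scope.
Local Open Scope classical_set_scope.

(* Algebras in the signature (vee, star, bot) of types (2, 2, 0). *)
Record halg := HAlg {
  carrier :> choiceType;
  vee : carrier -> carrier -> carrier;
  star : carrier -> carrier -> carrier;
  bot : carrier }.
Arguments vee {h}.
Arguments star {h}.
Arguments bot {h}.

Definition subalgebra (A : halg) (S : set A) : Prop :=
  [/\ S bot,
      forall x y, S x -> S y -> S (vee x y) &
      forall x y, S x -> S y -> S (star x y)].

Definition homomorphism (A B : halg) (f : A -> B) : Prop :=
  [/\ f bot = bot,
      forall x y, f (vee x y) = vee (f x) (f y) &
      forall x y, f (star x y) = star (f x) (f y)].

Definition endomorphism (A : halg) (f : A -> A) : Prop := homomorphism f.

Definition isomorphism (A B : halg) (f : A -> B) : Prop :=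
  homomorphism f /\ bijective f.

Definition automorphism (A : halg) (f : A -> A) : Prop := isomorphism f.

Definition isomorphic (A B : halg) : Prop :=
  exists f : A -> B, isomorphism f.

Definition nontrivial (A : halg) : Prop := exists x y : A, x <> y.

Definition finite_halg (A : halg) : Prop := finite_set [set: A].

Record congruence (A : halg) := Congruence {
  cong_rel :> A -> A -> Prop;
  cong_refl : forall x, cong_rel x x;
  cong_sym : forall x y, cong_rel x y -> cong_rel y x;
  cong_trans : forall x y z, cong_rel x y -> cong_rel y z -> cong_rel x z;
  cong_vee : forall x x' y y',
    cong_rel x x' -> cong_rel y y' -> cong_rel (vee x y) (vee x' y');
  cong_star : forall x x' y y',
    cong_rel x x' -> cong_rel y y' -> cong_rel (star x y) (star x' y') }.

Section Quotient.
Variables (A : halg) (theta : congruence A).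

Definition cong_relb : rel A := fun x y => `[< theta x y >].

Lemma cong_relb_class_of : equiv_class_of cong_relb.
Proof.
split=> [x|x y|y x z].
- by apply/asboolP; exact: cong_refl.
- by apply/asboolP/asboolP; exact: cong_sym.
- move=> /asboolP xy /asboolP yz; apply/asboolP; exact: cong_trans xy yz.
Qed.

Definition cong_equiv : equiv_rel A := EquivRelPack cong_relb_class_of.

Definition quotient : halg :=
  @HAlg {eq_quot cong_equiv}
    (fun p q => \pi_({eq_quot cong_equiv}) (vee (repr p) (repr q)))
    (fun p q => \pi_({eq_quot cong_equiv}) (star (repr p) (repr q)))
    (\pi_({eq_quot cong_equiv}) bot).

Definition proj : A -> quotient := \pi_({eq_quot cong_equiv}).

Lemma projE (x y : A) : proj x = proj y <-> theta x y.
Proof.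
split=> [/eqP|xy]; first by rewrite eqmodE => /asboolP.
by apply/eqP; rewrite eqmodE; apply/asboolP.
Qed.

(* The operations of the quotient do not depend on the representatives. *)
Lemma proj_hom : homomorphism proj.
Proof.
have rK (x : A) : theta x (repr (proj x)) by apply/projE; rewrite /proj reprK.
by split=> // x y; apply/projE; [apply: cong_vee | apply: cong_star]; exact: rK.
Qed.

End Quotient.

Definition residually_finite (A : halg) : Prop :=
  forall x y : A, x <> y ->
    exists theta : congruence A,
      finite_halg (quotient theta) /\ proj theta x <> proj theta y.

Definition power (A : halg) (n : nat) : halg :=
  @HAlg {ffun 'I_n -> A}
    (fun x y => [ffun i => vee (x i) (y i)])
    (fun x y => [ffun i => star (x i) (y i)])
    [ffun => bot].

(* Naturals with a bottom element: [None] is -oo, [Some k] is the height k. *)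
Notation height := (option nat).

Definition hmax (x y : height) : height :=
  match x, y with
  | None, _ => y
  | _, None => x
  | Some a, Some b => Some (maxn a b)
  end.

Definition hadd (x : height) (k : nat) : height := omap (addn^~ k) x.

Definition hstar (x y : height) : height := hadd (hmax x y) 1.

Definition H : halg := @HAlg height hmax hstar None.

Definition tail (m : nat) : set H :=
  [set x | exists2 k : nat, m <= k & x = Some k].

Definition tau (c : nat) : H -> H := fun x => hadd x c.

Definition theta_rel (m : nat) (x y : H) : Prop :=
  x = y \/ tail m x /\ tail m y.

Lemma tail_hmax m (x y : H) : tail m x -> tail m (hmax x y).
Proof.
move=> [a ma ->]; case: y => [b|] /=; last by exists a.
by exists (maxn a b) => //; rewrite leq_max ma.
Qed.

Lemma hmaxC : commutative hmax.
Proof. by move=> [a|] [b|] //=; rewrite maxnC. Qed.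

Lemma theta_hmax m x x' y y' : theta_rel m x x' -> theta_rel m y y' ->
  theta_rel m (hmax x y) (hmax x' y').
Proof.
move=> [->|[tx tx']] [->|[ty ty']]; first by left.
- by right; rewrite ![hmax x' _]hmaxC; split; exact: tail_hmax.
- by right; split; exact: tail_hmax.
- by right; split; exact: tail_hmax.
Qed.

Lemma theta_hadd m k x y :
  theta_rel m x y -> theta_rel m (hadd x k) (hadd y k).
Proof.
move=> [->|[[a ma ->] [b mb ->]]]; first by left.
by right; split; [exists (a + k) | exists (b + k)] => //; apply: leq_trans (leq_addr _ _).
Qed.

Definition theta (m : nat) : congruence H.
Proof.
apply: (@Congruence H (theta_rel m)).
- by move=> x; left.
- by move=> x y [->|[]]; [left | right].
- by move=> x y z [->//|[tx ty]] [<-|[_ tz]]; right.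
- exact: theta_hmax.
- by move=> x x' y y' xx' yy'; apply: theta_hadd; exact: theta_hmax.
Defined.

(* The algebra of heights capped at m, on {-oo, 0, ..., m}. *)
Definition cap (m : nat) (x : height) : option 'I_m.+1 :=
  omap (fun k => inord (minn k m)) x.

Definition uncap (m : nat) (x : option 'I_m.+1) : height :=
  omap (@nat_of_ord m.+1) x.

Definition capped (m : nat) : halg :=
  @HAlg (option 'I_m.+1)
    (fun x y => cap m (hmax (uncap x) (uncap y)))
    (fun x y => cap m (hstar (uncap x) (uncap y)))
    None.

Definition distributes_over (T : Type) (mul add : T -> T -> T) : Prop :=
  left_distributive mul add /\ right_distributive mul add.

Definition identity_element (T : Type) (e : T) (op : T -> T -> T) : Prop :=
  left_id e op /\ right_id e op.

(* Main.v *)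
(* Every clause rests on [x * -oo = x + 1]: subalgebras and congruences are
   stable under the successor and an endomorphism commutes with it, so each is
   determined by one finite height (the least element, the image of 0, or the
   least [m] identified with [m + 1]). Truncation at [m] has kernel [theta m],
   and these truncations separate points. *)
Require Import Defs.
From mathcomp Require Import all_boot.
From mathcomp Require Import boolp classical_sets functions cardinality.

Local Open Scope classical_set_scope.

Set Implicit Arguments.
Unset Strict Implicit.
Unset Printing Implicit Defensive.

(** * The join is determined by the product *)

(* Distributivity turns [-oo + b = b] into [d.+1 + b.+1 = b.+1] for [d <= b],
   multiplying by [d]; multiplying by [-oo] removes the successors. *)
Lemma distributive_eq_hmax (op : H -> H -> H) :
  commutative op -> identity_element (bot : H) op ->
  left_distributive hstar op -> op =2 hmax.
Proof.
move=> opC [op0x opx0] opD.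
have hadd1_inj : injective (hadd^~ 1).
  by move=> [a|] [b|] //= [] /addIn ->.
have op_le (d b : nat) : d <= b -> op (Some d) (Some b) = Some b.
  move=> db; apply: hadd1_inj.
  have := opD (Some d) (Some b) None; rewrite /hstar hmaxC /= => ->.
  have := opD None (Some b) (Some d); rewrite op0x /hstar /=.
  by rewrite (maxn_idPl db) => <-.
move=> [a|] [b|] /=; [|exact: opx0|exact: op0x|exact: op0x].
have [ab|ba] := leqP a b; first exact: op_le.
by rewrite opC op_le // ltnW.
Qed.

Lemma hmax_semilattice :
  [/\ commutative hmax, associative hmax, idempotent_op hmax,
      identity_element None hmax & distributes_over hstar hmax].
Proof.
have hmaxA : associative hmax by move=> [a|] [b|] [c|] //=; rewrite maxnA.
have hmaxxx : idempotent_op hmax by move=> [a|] //=; rewrite maxnn.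
have hadd_max x y : hadd (hmax x y) 1 = hmax (hadd x 1) (hadd y 1).
  by case: x y => [a|] [b|] //=; rewrite addn_maxl.
(* The join distributes over itself: idempotence absorbs the second [z]. *)
have hmaxACA x y z : hmax (hmax x y) z = hmax (hmax x z) (hmax y z).
  rewrite hmaxA -[hmax (hmax x z) y]hmaxA [hmax z y]hmaxC hmaxA -[RHS]hmaxA.
  by rewrite hmaxxx.
have starD : left_distributive hstar hmax.
  by move=> x y z; rewrite /hstar hmaxACA hadd_max.
have hstarC x y : hstar x y = hstar y x by rewrite /hstar hmaxC.
split=> //; first exact: hmaxC.
- by split=> -[].
- by split=> // x y z; rewrite hstarC starD !(hstarC x).
Qed.

(** * Subalgebras *)

(** Applied to a subalgebra, and later to the congruence classes of [bot] and of [Some m]. *)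
Lemma closed_hadd1_tail (P : H -> Prop) m :
  P (Some m) -> (forall x : H, P x -> P (hadd x 1)) ->
  forall k, m <= k -> P (Some k).
Proof.
move=> Pm PS k /subnK <-; elim: (k - m) => [//|n IHn].
by have := PS _ IHn; rewrite /= addn1.
Qed.

Lemma subalgebraP (S : set H) :
  subalgebra S <-> S = [set bot] \/ exists m : nat, S = bot |` tail m.
Proof.
split=> [[S0 Sv Ss]|[->|[m ->]]]; last first.
- have tail_star x y : tail m x -> tail m (hstar x y).
    move=> tx; have [a ma ab] := tail_hmax y tx.
    by rewrite /hstar ab; exists (a + 1) => //; apply: leq_trans (leq_addr _ _).
  split=> [|x y [->|tx] [->|ty]|x y [->|tx] [->|ty]] /=; try by left.
  + by right.
  + by right; rewrite hmaxC.
  + by right; exact: tail_hmax.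
  + by right; rewrite /hstar hmaxC; exact: tail_star.
  + by right; exact: tail_star.
  + by right; exact: tail_star.
- by split=> // _ _ -> ->.
(* The tail starts at the least finite height in [S]; [ex_minnP] wants a boolean predicate, hence
   the reflection. *)
have [exS|noS] := pselect (exists k, `[< S (Some k) >]); last first.
  left; apply/seteqP; split=> [[k|] Sk //=|x -> //].
  by case: noS; exists k; apply/asboolP.
right; case: (ex_minnP exS) => m /asboolP Sm minm; exists m.
apply/seteqP; split=> [[k|] Sk|x [->//|[k mk ->]]] //=.
- by right; exists k => //; apply: minm; apply/asboolP.
- by left.
- apply: closed_hadd1_tail Sm _ k mk => y Sy.
  have := Ss _ _ Sy S0.
  by rewrite /= /hstar hmaxC.
Qed.

(** * Endomorphisms and rigidity *)

Lemma endomorphism_cases (f : H -> H) : endomorphism f ->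
  f =1 (fun=> bot) \/ exists c : nat, f =1 tau c.
Proof.
move=> [f0 _ fs].
have fS k : f (Some k.+1) = hadd (f (Some k)) 1.
  have := fs (Some k) bot; rewrite f0 /= /hstar /= addn1 => ->.
  by rewrite hmaxC.
case f00: (f (Some 0)) => [c|]; [right; exists c|left].
- move=> [k|]; last exact: f0.
  by elim: k => [|k IHk]; rewrite ?f00 // fS IHk /tau /= addn1 addSn.
- move=> [k|]; last exact: f0.
  by elim: k => [|k IHk] //; rewrite fS IHk.
Qed.

Lemma automorphism_id (f : H -> H) : automorphism f <-> f =1 id.
Proof.
split=> [[fh [g fK gK]]|fE].
  (* Height 0 has a preimage: this excludes the constant map, and [k + c = 0] forces [c = 0]. *)
  case: (endomorphism_cases fh) => [f0|[c fc]].
    by have := gK (Some 0); rewrite f0.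
  have := gK (Some 0); rewrite fc; case: (g _) => [k|] //= [].
  move=> /eqP; rewrite addn_eq0 => /andP[_ /eqP c0] [x|]; rewrite fc c0 //.
  by rewrite /tau /= addn0.
split; last by exists id => x; rewrite fE.
by split=> [|x y|x y]; rewrite !fE.
Qed.

(** * Congruences *)

Section HeightCongruence.
Variable th : congruence H.

Lemma cong_hadd1 (x y : H) : th x y -> th (hadd x 1) (hadd y 1).
Proof.
move=> xy; have := cong_star xy (cong_refl th bot).
by rewrite /= /hstar ![hmax _ None]hmaxC.
Qed.

(** The class of [bot] is closed under successor, as [bot] is its own successor, so it contains
    every height from [k] on. For [j] below [k], joining both sides with [j] gives [j ~ k]. *)
Lemma cong_bot_universal k : th bot (Some k) -> forall x y : H, th x y.
Proof.
move=> bk; suff bx x : th bot x.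
  by move=> x y; apply: cong_trans (bx y); apply/cong_sym/bx.
case: x => [j|]; last exact: cong_refl.
have [kj|/ltnW jk] := leqP k j.
  apply: (closed_hadd1_tail (P := th bot)) bk _ j kj => x.
  exact: (@cong_hadd1 bot).
have := cong_vee bk (cong_refl th (Some j)).
rewrite /= (maxn_idPl jk) => jSk.
exact/(cong_trans bk)/cong_sym.
Qed.

(** Joining both sides with [a.+1] gives [a.+1 ~ b]. *)
Lemma cong_lt_succ a b : a < b -> th (Some a) (Some b) ->
  th (Some a) (Some a.+1).
Proof.
move=> ab tab; have := cong_vee tab (cong_refl th (Some a.+1)).
rewrite /= (maxn_idPl ab) (maxn_idPr (leqnSn a)) => tSb.
exact/(cong_trans tab)/cong_sym.
Qed.

(** The class of [m] is closed under successor: [m ~ x] gives [m.+1 ~ x + 1], and [m ~ m.+1]. *)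
Lemma cong_succ_tail m : th (Some m) (Some m.+1) ->
  forall k, m <= k -> th (Some m) (Some k).
Proof.
move=> mS k; apply: (closed_hadd1_tail (P := th (Some m))) => [|x mx].
  exact: cong_refl.
have := cong_hadd1 mx; rewrite /= addn1; exact: cong_trans.
Qed.

Lemma cong_classification :
  ~ (forall x y : H, th x y <-> x = y) -> ~ (forall x y : H, th x y) ->
  exists m : nat, forall x y : H, th x y <-> theta m x y.
Proof.
move=> neq nuniv.
have nbot k : ~ th bot (Some k) by move=> /cong_bot_universal.
(* The threshold is the least [k] with [k ~ k.+1]; if there is none, [th] is equality. *)
have [exS|noS] := pselect (exists k, `[< th (Some k) (Some k.+1) >]); last first.
  have nlt a b : a < b -> ~ th (Some a) (Some b).
    move=> ab tab; apply: noS; exists a.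
    by apply/asboolP; exact: cong_lt_succ tab.
  case: neq => x y; split=> [|->]; last exact: cong_refl.
  case: x y => [a|] [b|] // tab; last 2 first.
  - by case: (nbot a); exact: cong_sym.
  - by case: (nbot b).
  - case: (ltngtP a b) => [ab|ba|-> //]; first by case: (nlt _ _ ab).
    by case: (nlt _ _ ba); exact: cong_sym.
case: (ex_minnP exS) => m /asboolP mS minm; exists m => x y; split; last first.
  move=> [->|[[a ma ->] [b mb ->]]]; first exact: cong_refl.
  apply: cong_trans (cong_succ_tail mS mb).
  exact/cong_sym/cong_succ_tail.
(* By minimality of [m], two distinct identified heights both lie in the tail. *)
have lt_theta a b : a < b -> th (Some a) (Some b) ->
    tail m (Some a) /\ tail m (Some b).
  move=> ab tab; have ma : m <= a.
    by apply: minm; apply/asboolP; exact: cong_lt_succ tab.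
  by split; [exists a | exists b => //; exact: leq_trans (ltnW ab)].
case: x y => [a|] [b|] tab; last by left.
- case: (ltngtP a b) => [ab|ba|->]; last by left.
  + by right; exact: lt_theta.
  + by right; apply/and_comm; apply: lt_theta => //; exact: cong_sym.
- by case: (nbot a); exact: cong_sym.
- by case: (nbot b).
Qed.

End HeightCongruence.

(** [theta n] identifies [n] with [n.+1], so its inclusion in [theta n'] forces [n' <= n]. *)
Lemma theta_inj m m' : (forall x y : H, theta m x y <-> theta m' x y) -> m = m'.
Proof.
have le_theta n n' : (forall x y : H, theta n x y -> theta n' x y) -> n' <= n.
  have tn : theta n (Some n) (Some n.+1).
    by right; split; [exists n | exists n.+1].
  move=> /(_ _ _ tn) [[/eqP]|[[k n'k [->]] _]] //.
  by rewrite eqn_leq ltnn andbF.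
move=> E; apply/eqP; rewrite eqn_leq; apply/andP.
by split; apply: le_theta => x y /E.
Qed.

(** * Kernels and the first isomorphism theorem *)

Section Kernel.
Variables (A B : halg) (f : A -> B).
Hypothesis f_hom : homomorphism f.

Definition kernel : congruence A.
Proof.
apply: (@Congruence A (fun x y => f x = f y)) => //.
- by move=> x y z -> ->.
- by case: f_hom => _ fv _ x x' y y' xx' yy'; rewrite !fv xx' yy'.
- by case: f_hom => _ _ fs x x' y y' xx' yy'; rewrite !fs xx' yy'.
Defined.

End Kernel.

Section QuotientByKernel.
Variables (A B : halg) (th : congruence A) (f : A -> B).
Hypothesis thE : forall x y, th x y <-> f x = f y.

(** The map induced by [f]; by [thE] the choice of representative is immaterial. *)
Let g (q : quotient th) : B := f (repr q).

Lemma quotient_ind (P : quotient th -> Prop) :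
  (forall x, P (proj th x)) -> forall q, P q.
Proof. by move=> Pp q; rewrite -[q]reprK; exact: Pp. Qed.

Let g_proj x : g (proj th x) = f x.
Proof. by apply/thE/projE; rewrite /proj reprK. Qed.

Let g_inj : injective g.
Proof.
apply: quotient_ind => x; apply: quotient_ind => y.
by rewrite !g_proj => /thE/projE.
Qed.

Lemma quotient_by_kernel_finite : finite_halg B -> finite_halg (quotient th).
Proof.
move=> finB; have : finite_set (g @^-1` setT).
  by apply: finite_preimage => // p q _ _; exact: g_inj.
by rewrite preimage_setT.
Qed.

Lemma first_isomorphism : homomorphism f -> (forall z, exists x, f x = z) ->
  exists h : quotient th -> B,
    isomorphism h /\ forall x, h (proj th x) = f x.
Proof.
move=> [f0 fv fs] fsurj; exists g; split=> //; split.
  have [p0 pv ps] := proj_hom th.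
  split; first by rewrite -p0 g_proj.
  - apply: quotient_ind => x; apply: quotient_ind => y.
    by rewrite -pv !g_proj.
  - apply: quotient_ind => x; apply: quotient_ind => y.
    by rewrite -ps !g_proj.
(* The inverse sends [z] to the class of a chosen preimage; injectivity of [g] gives the second
   cancellation. *)
have [s sK] := choice fsurj.
have gK : cancel (proj th \o s) g by move=> z; rewrite /= g_proj.
by exists (proj th \o s) => // q; apply: g_inj; rewrite gK.
Qed.

End QuotientByKernel.

Lemma proj_surj (A : halg) (th : congruence A) (q : quotient th) :
  exists x, proj th x = q.
Proof. by exists (repr q); rewrite /proj reprK. Qed.

(** * Finite quotients and capped heights *)

Lemma finite_quotient_classification (th : congruence H) :
  finite_halg (quotient th) -> nontrivial (quotient th) ->
  exists m : nat, isomorphic (quotient th) (quotient (theta m)).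
Proof.
move=> fin [p [q npq]].
have [|/=|m thE] := @cong_classification th.
- move=> eqth; apply: infinite_nat.
  (* If [th] is equality, [h] maps the finite quotient onto all naturals; the default 0 only serves
     the class of [bot]. *)
  pose h (q : quotient th) : nat := odflt 0 (repr q : H).
  apply: sub_finite_set (finite_image h fin) => n _.
  exists (proj th (Some n)) => //; rewrite /h.
  suff -> : repr (proj th (Some n)) = Some n :> H by [].
  by apply/eqth/projE; rewrite /proj reprK.
- move=> univ; apply: npq; elim/quotient_ind: p => x.
  by elim/quotient_ind: q => y; apply/projE.
exists m.
have [|||h [hiso _]] := @first_isomorphism _ _ th (proj (theta m)).
- by move=> x y; rewrite thE projE.
- exact: proj_hom.
- exact: proj_surj.
by exists h.
Qed.

Lemma cap_theta m (x y : H) : theta m x y <-> cap m x = cap m y.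
Proof.
split=> [[->//|[[a ma ->] [b mb ->]]]|].
  by rewrite /cap /= (minn_idPr ma) (minn_idPr mb).
case: x y => [a|] [b|] //=; last by left.
have ltm k : minn k m < m.+1 by rewrite ltnS geq_minr.
move=> [] /(congr1 val); rewrite /= !inordK // => E.
(* In the mixed cases one capped value is [m] and the other is smaller. *)
have [ma|am] := leqP m a; have [mb|bm] := leqP m b.
- by right; split; [exists a | exists b].
- move: E bm; rewrite (minn_idPr ma) => ->.
  by rewrite ltnNge geq_min leqnn.
- move: E am; rewrite (minn_idPr mb) => <-.
  by rewrite ltnNge geq_min leqnn.
- by left; move: E; rewrite (minn_idPl (ltnW am)) (minn_idPl (ltnW bm)) => ->.
Qed.

Lemma uncap_theta m (x : H) : theta m (uncap (cap m x)) x.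
Proof.
case: x => [k|] /=; last by left.
rewrite inordK ?ltnS ?geq_minr //.
have [mk|/ltnW km] := leqP m k; last by left.
by right; split; [exists m | exists k].
Qed.

(** [capped m] computes on the representatives [uncap (cap m x)], which are [theta m]-related to
    [x], so compatibility of [theta m] suffices. *)
Lemma cap_hom m : homomorphism (cap m : H -> capped m).
Proof.
split=> // x y; apply/cap_theta/cong_sym.
- by apply: (cong_vee (c := theta m)); exact: uncap_theta.
- by apply: (cong_star (c := theta m)); exact: uncap_theta.
Qed.

Lemma capK m (z : capped m) : cap m (uncap z) = z.
Proof.
case: z => [i|] //=; congr Some; apply: val_inj.
have im : i <= m by rewrite -ltnS.
by rewrite /= (minn_idPl im) inordK.
Qed.

Lemma quotient_theta_finite m : finite_halg (quotient (theta m)).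
Proof.
apply: (@quotient_by_kernel_finite H (capped m) _ (cap m)).
  exact: cap_theta.
exact: (@finite_finset (option 'I_m.+1)).
Qed.

Lemma quotient_theta_nontrivial m : nontrivial (quotient (theta m)).
Proof.
exists (proj (theta m) None), (proj (theta m) (Some 0)).
by move=> /projE/cap_theta.
Qed.

(** * Residual finiteness *)

(** The quotient by the kernel of [f] injects into the finite [B]. *)
Lemma residually_finiteP (A : halg) :
  (forall x y : A, x <> y -> exists (B : halg) (f : A -> B),
     [/\ finite_halg B, homomorphism f & f x <> f y]) ->
  residually_finite A.
Proof.
move=> sep x y /sep [B [f [finB fh fxy]]]; exists (kernel fh); split.
  exact: (@quotient_by_kernel_finite _ _ _ f).
by move=> /projE.
Qed.

Lemma residually_finite_H : residually_finite H.
Proof.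
move=> x y nxy.
(* The threshold exceeds both heights, so neither point lies in the collapsed tail; the default 0
   stands in for [bot]. *)
pose m := (maxn (odflt 0 (x : height)) (odflt 0 (y : height))).+1.
exists (theta m); split; first exact: quotient_theta_finite.
move=> /projE [//|[[a ma xa] _]].
by move: ma; rewrite /m xa /= ltnNge leq_max leqnn.
Qed.

Lemma residually_finite_power (A : halg) n :
  residually_finite A -> residually_finite (power A n).
Proof.
move=> Afin; apply: residually_finiteP => x y nxy.
have [i nxyi] : exists i, x i <> y i.
  by apply/existsNP => E; apply: nxy; apply/ffunP.
have [th [fin sep]] := Afin _ _ nxyi.
(* Project to a coordinate where the tuples differ, then to a finite quotient separating the two
   entries. *)
exists (quotient th), (fun z : power A n => proj th (z i)); split=> //.
by have [p0 pv ps] := proj_hom th; split=> [|u v|u v]; rewrite ?ffunE.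
Qed.

Theorem theorem1p4 :
  (* (1) *)
  (forall op : H -> H -> H,
     [/\ commutative op, associative op, idempotent_op op,
         identity_element bot op & distributes_over hstar op]
     <-> op =2 hmax) /\
  (* (2) *)
  (forall S : set H,
     subalgebra S <->
     S = [set bot] \/ exists m : nat, S = bot |` tail m) /\
  (* (3) *)
  (forall f : H -> H, endomorphism f ->
     f =1 (fun=> bot) \/ exists c : nat, f =1 tau c) /\
  (forall f : H -> H, automorphism f <-> f =1 id) /\
  (* (4) *)
  (forall th : congruence H,
     ~ (forall x y : H, th x y <-> x = y) ->
     ~ (forall x y : H, th x y) ->
     exists! m : nat, forall x y : H, th x y <-> theta m x y) /\
  (forall th : congruence H,
     finite_halg (quotient th) -> nontrivial (quotient th) ->
     exists m : nat, isomorphic (quotient th) (quotient (theta m))) /\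
  (forall m : nat,
     [/\ finite_halg (quotient (theta m)),
         nontrivial (quotient (theta m)) &
         exists f : quotient (theta m) -> capped m,
           isomorphism f /\ forall x : H, f (proj (theta m) x) = cap m x]) /\
  (* (5) *)
  residually_finite H /\
  (forall n : nat, residually_finite (power H n)).
Proof.
split.
  move=> op; split=> [[opC _ _ op0 [opD _]]|opE].
    exact: distributive_eq_hmax.
  suff -> : op = hmax by exact: hmax_semilattice.
  by apply/funext => x; apply/funext => y; exact: opE.
split; first exact: subalgebraP.
split; first exact: endomorphism_cases.
split; first exact: automorphism_id.
split.
  move=> th neq nuniv; have [m thE] := cong_classification neq nuniv.
  exists m; split=> // m' thE'; apply: theta_inj => x y.
  by rewrite -thE -thE'.
split; first exact: finite_quotient_classification.
split.
  move=> m; split; [exact: quotient_theta_finite| exact: quotient_theta_nontrivial|].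
  apply: first_isomorphism; [exact: cap_theta | exact: cap_hom |].
  by move=> z; exists (uncap z); exact: capK.
split; first exact: residually_finite_H.
by move=> n; apply: residually_finite_power; exact: residually_finite_H.
Qed.
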